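(* Let $F$ be a strongly symmetric norm on $\mathbb{R}^2$. Every irrational $\alpha\in\mathbb{R}$ has a unique semi-regular continued fraction expansion whose set of convergents is precisely the set of best approximations to $\alpha$ with respect to $F$.
   Context: A norm $F$ on $\mathbb{R}^2$ is strongly symmetric if $F(x,y)=F(|x|,|y|)$ for all $(x,y)$ and $F(0,\pm1)=F(\pm1,0)=1$. For $t>0$ put $F_t(x,y)=F(t^{-1}x,ty)$. A semi-regular continued fraction is a formal expression $a_0+\frac{\varepsilon_1}{a_1+}\frac{\varepsilon_2}{a_2+}\frac{\varepsilon_3}{a_3+}\cdots$ with $a_0\in\mathbb{Z}$, $a_m\in\mathbb{Z}$, $a_m>0$ and $\varepsilon_m\in\{\pm1\}$ for $m\ge1$, such that $a_m+\varepsilon_{m+1}\ge1$ for all $m\ge1$ and $a_m+\varepsilon_{m+1}\ge2$ for infinitely many $m$. Its $m$-th convergent ($m\ge0$) is the rational number $\frac{p_m}{q_m}=a_0+\frac{\varepsilon_1}{a_1+}\frac{\varepsilon_2}{a_2+}\cdots\frac{\varepsilon_m}{a_m}$ (with $p_m,q_m$ coprime, $q_m>0$); it is an expansion of $\alpha$ if $\frac{p_m}{q_m}\to\alpha$. A rational $\frac pq$ with $q>0$ is a best approximation to $\alpha$ with respect to $F$ if there exists $t>1$ such that $F_t(q,p-\alpha q)<F_t(s,r-\alpha s)$ for all rationals $\frac rs\ne\frac pq$. *)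

(* Defs.v *)
From HB Require Import structures.
From mathcomp Require Import all_boot all_order all_algebra.
From mathcomp Require Import all_classical all_reals all_analysis.

Set Implicit Arguments.
Unset Strict Implicit.
Unset Printing Implicit Defensive.

Import Order.TTheory GRing.Theory Num.Theory.
Import numFieldNormedType.Exports.

Local Open Scope classical_set_scope.
Local Open Scope ring_scope.

Definition is_norm2 (R : realType) (F : R -> R -> R) : Prop :=
  [/\ forall x y, 0 <= F x y,
      forall x y, F x y = 0 -> x = 0 /\ y = 0,
      forall c x y, F (c * x) (c * y) = `|c| * F x y &
      forall x y x' y', F (x + x') (y + y') <= F x y + F x' y'].

Definition strongly_symmetric_norm (R : realType) (F : R -> R -> R) : Prop :=
  [/\ is_norm2 F,
      forall x y, F x y = F `|x| `|y|,
      F 0 1 = 1 /\ F 0 (-1) = 1 &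
      F 1 0 = 1 /\ F (-1) 0 = 1].

Definition scaled_norm (R : realType) (F : R -> R -> R) (t x y : R) : R :=
  F (t^-1 * x) (t * y).

(* The formal expression a_0 + e_1/(a_1 + e_2/(a_2 + ...)), where
   [cf_den c m] is a_m and [cf_num c m] is e_(m+1): there is no e_0, so two
   such expressions are equal exactly when the records are. *)
Record cfrac := CFrac { cf_den : nat -> int ; cf_num : nat -> int }.

Definition semi_regular (c : cfrac) : Prop :=
  [/\ forall m, (1 <= m)%N -> 0 < cf_den c m,
      forall m, cf_num c m = 1 \/ cf_num c m = -1,
      forall m, (1 <= m)%N -> 1 <= cf_den c m + cf_num c m &
      infinite_set [set m : nat | (1 <= m)%N /\ 2 <= cf_den c m + cf_num c m]].

(* a_k + e_(k+1)/(a_(k+1) + ... + e_(k+n)/a_(k+n)); when [c] is semi-regular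
   every denominator occurring here is at least 1. *)
Fixpoint cf_segment (c : cfrac) (k n : nat) : rat :=
  if n is n'.+1 then
    (cf_den c k)%:~R + (cf_num c k)%:~R / cf_segment c k.+1 n'
  else (cf_den c k)%:~R.

Definition convergent (c : cfrac) (m : nat) : rat := cf_segment c 0 m.

Definition expansion_of (R : realType) (c : cfrac) (alpha : R) : Prop :=
  (ratr (convergent c m) : R) @[m --> \oo] --> alpha.

(* F_t(q, p - alpha q) for x = p/q in lowest terms with q > 0 *)
Definition approx_size (R : realType) (F : R -> R -> R) (alpha t : R)
    (x : rat) : R :=
  scaled_norm F t (denq x)%:~R ((numq x)%:~R - alpha * (denq x)%:~R).

Definition best_approximation (R : realType) (F : R -> R -> R) (alpha : R)
    (x : rat) : Prop :=
  exists t : R, 1 < t /\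
    forall y : rat, y <> x -> approx_size F alpha t x < approx_size F alpha t y.

(* Main.v *)
(* Write [err x = |p - alpha q|] for [x = p/q].  Since [t * F_t] depends only on
   [T = t^2], best approximations are the strict minimisers of
   [x |-> F q (T * err x)] for some [T > 1].  Convexity of [F] gives a single
   crossing property: once a vector with larger denominator and smaller error is
   at least as short, it stays strictly shorter for all larger [T].  Hence two
   best approximations that are consecutive by denominator are both shortest
   vectors at the parameter where they have equal norm, and a shortest-vector
   argument shows that they have determinant 1 or -1 (determinant 2 is the only
   delicate case).  This yields the recurrence
   [v_(m+1) = a_(m+1) v_m + e_(m+1) v_(m-1)], and the sizes of the errors force
   the semi-regularity conditions.  Conversely, errors of the convergents of any
   semi-regular expansion of an irrational number strictly decrease, so the set of
   convergents determines their order and thus the expansion. *)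

Require Import Defs.
From mathcomp Require Import all_boot all_order all_algebra.
From mathcomp Require Import all_classical all_reals all_analysis.
From mathcomp Require Import ring lra zify.

Set Implicit Arguments.
Unset Strict Implicit.
Unset Printing Implicit Defensive.

Import Order.TTheory GRing.Theory Num.Theory.
Import numFieldNormedType.Exports.

Local Open Scope classical_set_scope.
Local Open Scope ring_scope.

(** * Strongly symmetric norms *)

Lemma swap_strongly_symmetric_norm (R : realType) (F : R -> R -> R) :
  strongly_symmetric_norm F -> strongly_symmetric_norm (fun x y => F y x).
Proof.
move=> [[F0 Fd FZ FD] Fa [F1 F2] [F3 F4]]; split=> //; split=> //.
by move=> x y /Fd[].
Qed.

Section StronglySymmetricNorm.
Variables (R : realType) (F : R -> R -> R).
Hypothesis hF : strongly_symmetric_norm F.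

Lemma ssnormZ c x y : F (c * x) (c * y) = `|c| * F x y.
Proof. by case: hF => -[]. Qed.

Lemma ssnormD x y x' y' : F (x + x') (y + y') <= F x y + F x' y'.
Proof. by case: hF => -[]. Qed.

Lemma ssnorm_abs x y : F x y = F `|x| `|y|.
Proof. by case: hF. Qed.

Lemma ssnormZ_ge0 c x y : 0 <= c -> F (c * x) (c * y) = c * F x y.
Proof. by move=> c0; rewrite ssnormZ ger0_norm. Qed.

Lemma ssnorm_x0 x : F x 0 = `|x|.
Proof.
case: hF => _ _ _ [F10 _].
by rewrite -[x in LHS]mulr1 -[0 in LHS](mulr0 x) ssnormZ F10 mulr1.
Qed.

Lemma ssnorm_0y y : F 0 y = `|y|.
Proof.
case: hF => _ _ [F01 _] _.
by rewrite -[y in LHS]mulr1 -[0 in LHS](mulr0 y) ssnormZ F01 mulr1.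
Qed.

Lemma ssnorm_convex s x y x' y' : 0 <= s -> s <= 1 ->
  F ((1 - s) * x + s * x') ((1 - s) * y + s * y') <=
  (1 - s) * F x y + s * F x' y'.
Proof.
move=> s0 s1; apply: (le_trans (ssnormD _ _ _ _)).
by rewrite !ssnormZ_ge0 // subr_ge0.
Qed.

Lemma ssnorm_convexr s x y y' : 0 <= s -> s <= 1 ->
  F x ((1 - s) * y + s * y') <= (1 - s) * F x y + s * F x y'.
Proof.
move=> s0 s1; have := @ssnorm_convex s x y x y' s0 s1.
by rewrite (_ : (1 - s) * x + s * x = x) //; ring.
Qed.

Lemma ssnorm_convexl s x x' y : 0 <= s -> s <= 1 ->
  F ((1 - s) * x + s * x') y <= (1 - s) * F x y + s * F x' y.
Proof.
move=> s0 s1; have := @ssnorm_convex s x y x' y s0 s1.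
by rewrite (_ : (1 - s) * y + s * y = y) //; ring.
Qed.

(** The point [(|x|, |y|)] lies on the segment between [(|x|, -|y'|)] and [(|x|, |y'|)], whose ends
    have equal norm, so convexity applies. *)
Lemma ssnorm_ler x y y' : `|y| <= `|y'| -> F x y <= F x y'.
Proof.
move=> yy'; rewrite ssnorm_abs [leRHS]ssnorm_abs.
have [y'0|y'0] := eqVneq y' 0.
  by move: yy'; rewrite y'0 normr0 normr_le0 => /eqP ->; rewrite normr0.
have y'_gt0 : 0 < `|y'| by rewrite normr_gt0.
set u := `|y| in yy' *; set v := `|y'| in yy' y'_gt0 *.
have u0 : 0 <= u by rewrite normr_ge0.
have uv : u / v <= 1 by rewrite ler_pdivrMr // mul1r.
have uv0 : 0 <= u / v by rewrite divr_ge0 // ltW.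
set w := u / v in uv uv0; have uE : u = w * v by rewrite /w divfK // gt_eqF.
have := @ssnorm_convexr ((1 + w) / 2) `|x| (- v) v.
have -> : (1 - (1 + w) / 2) * - v + (1 + w) / 2 * v = u by rewrite uE; field.
have -> : F `|x| (- v) = F `|x| v.
  by rewrite ssnorm_abs normrN -ssnorm_abs.
move=> /(_ ltac:(lra) ltac:(lra)) /le_trans; apply.
by rewrite -mulrDl subrK mul1r.
Qed.

Lemma ssnorm_ge_y x y : `|y| <= F x y.
Proof.
have := ssnormD x y (- x) y; rewrite subrr ssnorm_0y.
rewrite (ssnorm_abs (- x)) normrN -ssnorm_abs => h.
have : `|y + y| = `|y| + `|y| by rewrite -mulr2n normrMn mulr2n.
by move=> E; rewrite E in h; lra.
Qed.

Lemma ssnorm_ge_x x y : `|x| <= F x y.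
Proof. by rewrite -ssnorm_x0; apply: ssnorm_ler; rewrite normr0. Qed.

Lemma ssnorm_le_add x y : F x y <= `|x| + `|y|.
Proof.
have := ssnormD x 0 0 y; by rewrite addr0 add0r ssnorm_x0 ssnorm_0y.
Qed.

Lemma ssnorm_lipschitzr x y y' : `|F x y - F x y'| <= `|y - y'|.
Proof.
have h z z' : F x z <= F x z' + `|z - z'|.
  have := ssnormD x z' 0 (z - z').
  by rewrite addr0 ssnorm_0y addrC subrK.
rewrite ler_norml; have := h y y'; have := h y' y; rewrite distrC; lra.
Qed.

(** A convex function that fails to grow from [y] to [y'] cannot have grown from [0] to [y], so its
    value at [y] is still [F x 0]. *)
Lemma ssnorm_flatr x y y' : 0 <= y -> y < y' -> F x y' <= F x y -> F x y = `|x|.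
Proof.
move=> y0 yy' le; have y'0 : 0 < y' by apply: le_lt_trans yy'.
have s1 : y / y' < 1 by rewrite ltr_pdivrMr // mul1r.
have s0 : 0 <= y / y' by rewrite divr_ge0 // ltW.
have := @ssnorm_convexr (y / y') x 0 y' s0 (ltW s1).
rewrite mulr0 add0r divfK ?gt_eqF // ssnorm_x0 => h.
have := ssnorm_ge_x x y; nra.
Qed.

End StronglySymmetricNorm.

(** * Strict monotonicity, chord slopes and the single crossing property *)

Section SingleCrossing.
Variables (R : realType) (F : R -> R -> R).
Hypothesis hF : strongly_symmetric_norm F.

Let hG := swap_strongly_symmetric_norm hF.

Lemma ssnorm_lel x x' y : `|x| <= `|x'| -> F x y <= F x' y.
Proof. exact: (ssnorm_ler hG). Qed.

Lemma ssnorm_flatl x x' y : 0 <= x -> x < x' -> F x' y <= F x y -> F x y = `|y|.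
Proof. exact: (ssnorm_flatr hG). Qed.

(** Growth of one coordinate alone need not increase [F]. When both grow, [(x, y)] is dominated by
    [k * (x', y')] with [k < 1]. *)
Lemma ssnorm_lt x y x' y' : 0 <= x -> x < x' -> 0 <= y -> y < y' ->
  F x y < F x' y'.
Proof.
move=> x0 xx' y0 yy'.
have x'0 : 0 < x' by apply: le_lt_trans xx'.
have y'0 : 0 < y' by apply: le_lt_trans yy'.
pose k := Num.max (x / x') (y / y').
have k1 : k < 1 by rewrite /k gt_max !ltr_pdivrMr // !mul1r xx' yy'.
have xk : x <= k * x' by rewrite -ler_pdivrMr // /k le_max lexx.
have yk : y <= k * y' by rewrite -ler_pdivrMr // /k le_max lexx orbT.
have k0 : 0 <= k by rewrite /k le_max divr_ge0 // ltW.
apply: (@le_lt_trans _ _ (F (k * x') (k * y'))).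
  apply: (@le_trans _ _ (F (k * x') y)).
    by apply: ssnorm_lel; rewrite !ger0_norm // mulr_ge0 // ltW.
  by apply: (ssnorm_ler hF); rewrite !ger0_norm // mulr_ge0 // ltW.
rewrite (ssnormZ_ge0 hF) //.
have : 0 < F x' y'.
  by apply: lt_le_trans (ssnorm_ge_x hF x' y'); rewrite normr_gt0 gt_eqF.
by move=> Fpos; rewrite gtr_pMl.
Qed.

(** Monotonicity of chord slopes with denominators cleared: both slopes are compared with the slope
    over [[a, d]]. *)
Lemma ssnorm_chordl (a b c d y : R) : a <= b -> a <= c -> b <= d -> c < d ->
  (F b y - F a y) * (d - c) <= (F d y - F c y) * (b - a).
Proof.
move=> ab ac bd cd; have ad : 0 < d - a by lra.
have conv z : a <= z -> z <= d ->
    (F z y - F a y) * (d - a) <= (F d y - F a y) * (z - a).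
  move=> az zd.
  have := @ssnorm_convexl R F hF ((z - a) / (d - a)) a d y.
  have -> : (1 - (z - a) / (d - a)) * a + (z - a) / (d - a) * d = z.
    by field; rewrite gt_eqF.
  rewrite divr_ge0 ?subr_ge0 ?(le_trans az) // ler_pdivrMr // mul1r lerD2r.
  move=> /(_ isT zd) h.
  have -> : (F d y - F a y) * (z - a) =
      (F d y - F a y) * ((z - a) / (d - a)) * (d - a).
    by field; rewrite gt_eqF.
  rewrite ler_pM2r //; lra.
have hb := conv b ab bd; have hc := conv c ac (ltW cd).
have {hb} : (F b y - F a y) * (d - c) * (d - a) <=
    (F d y - F a y) * (b - a) * (d - c) by nra.
have {hc} : (F d y - F a y) * (d - c) * (b - a) <=
    (F d y - F c y) * (b - a) * (d - a) by nra.
move=> h1 h2; rewrite -(ler_pM2r ad); lra.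
Qed.


(* Rescaling both points to the height [S * e'] turns the claim into a
   comparison of chord slopes of the convex function [x |-> F x (S * e')]. *)
Lemma ssnorm_crossing (q q' e e' T S : R) :
  0 <= q -> q < q' -> 0 < e' -> e' < e -> 0 < T -> T < S ->
  F q' (T * e') <= F q (T * e) -> F q' (S * e') < F q (S * e).
Proof.
move=> q0 qq' e'0 ee' T0 TS le; rewrite ltNge; apply/negP => ge.
have e0 : 0 < e by apply: lt_trans ee'.
have S0 : 0 < S by apply: lt_trans TS.
pose k := S / T; pose r := e / e'.
have k1 : 1 < k by rewrite /k ltr_pdivlMr // mul1r.
have r1 : 1 < r by rewrite /r ltr_pdivlMr // mul1r.
have SE : S = k * T by rewrite /k divfK // gt_eqF.
have eE : e = r * e' by rewrite /r divfK // gt_eqF.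
have k0 : 0 < k by lra.
have r0 : 0 < r by lra.
pose f x := F x (S * e').
have fe x : F x (S * e) = r * f (x / r).
  rewrite /f -(ssnormZ_ge0 hF) ?(ltW r0) //.
  by congr F; [field; rewrite gt_eqF|rewrite eE; ring].
have le1 : f (k * q') <= r * f (k * q / r).
  have Sz z : S * z = k * (T * z) by rewrite mulrA -SE.
  rewrite -fe /f (Sz e') (Sz e).
  by rewrite (ssnormZ_ge0 hF _ _ (ltW k0)) (ssnormZ_ge0 hF _ _ (ltW k0)) ler_pM2l.
have le2 : r * f (q / r) <= f q' by rewrite -fe.
have qr : q / r <= q by rewrite ler_pdivrMr //; nra.
have qr0 : 0 <= q / r by rewrite divr_ge0 // ltW.
have kqr : k * q / r = k * (q / r) by rewrite mulrA.
rewrite kqr in le1.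
have := @ssnorm_chordl (q / r) (k * (q / r)) q' (k * q') (S * e').
move=> /(_ ltac:(nra) ltac:(nra) ltac:(nra) ltac:(nra)); rewrite -!/(f _) => ch.
have fmono : f q' <= f (k * q').
  by apply: ssnorm_lel; rewrite !ger0_norm; nra.
have {ch} ch : (f (k * (q / r)) - f (q / r)) * q' <=
    (f (k * q') - f q') * (q / r).
  have k1' : 0 < k - 1 by lra.
  by rewrite -(ler_pM2r k1'); nra.
have qE : q = r * (q / r) by rewrite mulrC divfK // gt_eqF.
(* With [X = f (k * q')] and [Y = f q'], the bounds [le1], [le2] and the chord inequality give
   [(X - Y) * q' <= (X - Y) * q]; since [q < q'], this forces [X <= Y]. *)
have : f (k * q') <= f q'.
  set X := f (k * q') in ch le1 fmono *; set Y := f q' in ch le2 fmono *.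
  have h1 : (X - Y) * q' <= r * (f (k * (q / r)) - f (q / r)) * q'.
    by rewrite ler_pM2r; nra.
  have h2 : r * (f (k * (q / r)) - f (q / r)) * q' <= (X - Y) * q.
    by rewrite [in leRHS]qE; nra.
  nra.
(* Flatness pins [f q'] to the height [S * e'], yet [ge] makes it at least [F q (S * e) >= S * e],
   which is larger. *)
move=> fl; have : f q' = `|S * e'|.
  by apply: ssnorm_flatl fl; nra.
rewrite ger0_norm; last by nra.
have : `|S * e| <= F q (S * e) by apply: (ssnorm_ge_y hF).
rewrite ger0_norm; last by nra.
move: ge; rewrite -/(f q'); nra.
Qed.

(** This excludes determinant 2. If both halves had norm at least [l], the one of height
    [y = (|e| - |e'|) / 2] would give [l <= F m y], while the midpoint of [(q, |e|)] and
    [(q', |e'|)] gives [F m y' <= l] at a greater height. Flatness then yields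
    [l <= m < q' <= l]. *)
Lemma ssnorm_half_sum_lt (q q' e e' l : R) :
  0 < q -> q < q' -> e' != 0 -> `|e'| < `|e| -> F q e = l -> F q' e' = l ->
  l <= F ((q' - q) / 2) ((e' - e) / 2) ->
  F ((q' + q) / 2) ((e' + e) / 2) < l.
Proof.
move=> q0 qq' e'0 ee' vl wl h1; rewrite ltNge; apply/negP => h2.
pose m : R := (q' + q) / 2; pose y : R := (`|e| - `|e'|) / 2.
pose y' : R := (`|e| + `|e'|) / 2.
have e'_gt0 : 0 < `|e'| by rewrite normr_gt0.
have le_my : l <= F m y.
  have abs_min (z z' : R) : `|z'| < `|z| ->
      `|z' - z| = `|z| - `|z'| \/ `|z' + z| = `|z| - `|z'|.
    have [z0|z0] := ger0P z; have [z'0|z'0] := ger0P z' => lt.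
    - by left; rewrite ler0_norm; lra.
    - by right; rewrite ger0_norm; lra.
    - by right; rewrite ler0_norm; lra.
    - by left; rewrite ger0_norm; lra.
  have half (z : R) : `|z / 2| = `|z| / 2.
    by rewrite normrM (@ger0_norm _ 2^-1) ?invr_ge0.
  have [E|E] := abs_min _ _ ee'; [apply: (le_trans h1)|apply: (le_trans h2)].
    rewrite (ssnorm_abs hF) (half (e' - e)) E -/y; apply: ssnorm_lel.
    by rewrite normr_id !ger0_norm /m; lra.
  by rewrite (ssnorm_abs hF) (half (e' + e)) E -/y (ssnorm_abs hF m)
    (@ger0_norm _ y) ?(@ger0_norm _ m) // /y /m; lra.
have y0 : 0 <= y by rewrite /y; lra.
have yy' : y < y' by rewrite /y /y'; lra.
have le_my' : F m y' <= l.
  have := @ssnorm_convex _ _ hF (1/2) q `|e| q' `|e'|.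
  have -> : (1 - 1 / 2) * q + 1 / 2 * q' = m by rewrite /m; field.
  have -> : (1 - 1 / 2) * `|e| + 1 / 2 * `|e'| = y' by rewrite /y'; field.
  have -> : F q `|e| = l by rewrite -vl (ssnorm_abs hF) normr_id -(ssnorm_abs hF).
  have -> : F q' `|e'| = l by rewrite -wl (ssnorm_abs hF) normr_id -(ssnorm_abs hF).
  by move=> /(_ ltac:(lra) ltac:(lra)); lra.
have := ssnorm_flatr hF y0 yy' (le_trans le_my' le_my).
rewrite ger0_norm /m; last by lra.
have := ssnorm_ge_x hF q' e'; rewrite wl ger0_norm; last by lra.
move: le_my; rewrite /m; lra.
Qed.

End SingleCrossing.

(** * Approximations to an irrational number *)

Lemma lipschitz_IVT (R : realType) (f : R -> R) (k a b v : R) :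
  (forall x y, `|f x - f y| <= k * `|x - y|) -> a <= b ->
  f a <= v -> v <= f b -> exists x, [/\ a <= x, x <= b & f x = v].
Proof.
move=> lf ab fav vfb.
have k0 : 0 <= k.
  have := lf 0 1; rewrite sub0r normrN normr1 mulr1; apply: le_trans.
  exact: normr_ge0.
have cf : {within `[a, b], continuous f}.
  apply: continuous_subspaceT => x.
  apply/cvgrPdist_le => e e0; near=> y.
  apply: (le_trans (lf x y)).
  apply: (@le_trans _ _ ((k + 1) * `|x - y|)).
    by rewrite ler_wpM2r // lerDl.
  rewrite mulrC -ler_pdivlMr; last by lra.
  near: y; apply: cvgr_dist_le; first exact: cvg_id.
  by rewrite divr_gt0 //; lra.
have [|x /[!in_itv]/= /andP[ax xb] fx] := @IVT R f a b v ab cf.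
  by rewrite ge_min fav le_max vfb orbT.
by exists x.
Unshelve. all: by end_near. Qed.

Lemma finite_argmin (R : realType) (T : eqType) (A : set T) (f : T -> R) :
  finite_set A -> A !=set0 -> exists2 x, A x & forall y, A y -> f x <= f y.
Proof.
move=> /finite_seqP[s ->]; elim: s => [[x]//|a s IH] _.
case: s IH => [|b s] IH.
  by exists a => [|y]; rewrite /= ?mem_head // inE => /eqP ->.
have [|x /= xs xmin] := IH; first by exists b; rewrite /= mem_head.
have [fax|fxa] := leP (f a) (f x).
  exists a => [|y]; rewrite /= ?mem_head // in_cons => /predU1P[->//|ys].
  exact: le_trans fax (xmin _ ys).
exists x => [|y]; rewrite /= in_cons ?xs ?orbT // => /predU1P[->|/xmin//].
exact: ltW.
Qed.

Section Irrational.
Variables (R : realType) (alpha : R).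
Hypothesis halpha : irrational alpha.

Definition approx_err (x : rat) : R :=
  `|(numq x)%:~R - alpha * (denq x)%:~R|.

Lemma irrational_intM (p q : int) : p%:~R = alpha * q%:~R -> q = 0.
Proof.
move=> pq; apply/eqP/negP => /negP q0; apply: halpha.
exists (p%:~R / q%:~R) => //.
rewrite fmorph_div /= !ratr_int pq mulfK // intr_eq0 //.
Qed.

Lemma approx_err_ge0 x : 0 <= approx_err x.
Proof. exact: normr_ge0. Qed.

Lemma approx_signed_neq0 (p q : int) : q != 0 -> p%:~R - alpha * q%:~R != 0.
Proof.
by move=> /eqP q0; rewrite subr_eq0; apply/eqP => /irrational_intM.
Qed.

Lemma approx_err_gt0 x : 0 < approx_err x.
Proof. by rewrite normr_gt0 approx_signed_neq0 ?denq_neq0. Qed.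

Lemma rat_ext (x y : rat) : numq x = numq y -> denq x = denq y -> x = y.
Proof.
by move=> nn dd; rewrite -(divq_num_den x) nn dd divq_num_den.
Qed.

(** Signed errors equal up to sign give an integer relation with [alpha], so by irrationality the
    denominators are equal or opposite; positivity excludes the latter. *)
Lemma approx_err_inj x y : approx_err x = approx_err y -> x = y.
Proof.
move=> /eqP; rewrite eqr_norm2 => /orP[]/eqP E.
  have dd : denq x - denq y = 0.
    by apply: (@irrational_intM (numq x - numq y)); rewrite !rmorphB /=; lra.
  have {}dd : denq x = denq y by lia.
  apply: rat_ext => //; move: E; rewrite dd => /addIr /eqP.
  by rewrite eqr_int => /eqP.
have dd : denq x + denq y = 0.
  by apply: (@irrational_intM (numq x + numq y)); rewrite !rmorphD /=; lra.
by have := denq_gt0 x; have := denq_gt0 y; lia.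
Qed.

Lemma lattice_multiple (p q : int) : q != 0 ->
  exists k : int, exists x : rat,
    [/\ k != 0, p = k * numq x & q = k * denq x].
Proof.
move=> q0; have := erefl (p%:Q / q%:Q).
case: {-}(p%:Q / q%:Q) / (divqP p q) q0 => [/eqP//|k x k0 _ _].
by exists k, x.
Qed.

Lemma one_le_normz (k : int) : k != 0 -> 1 <= `|k%:~R : R|.
Proof.
by move=> k0; rewrite -intr_norm -[1]/(1%:~R) ler_int; lia.
Qed.

Lemma nearest_integer : exists2 x : rat, denq x = 1 & approx_err x < 1 / 2.
Proof.
pose p := Num.floor (alpha + 1 / 2).
have /andP[p1 p2] := floor_itv (alpha + 1 / 2); rewrite -/p in p1 p2.
exists p%:~R; rewrite ?denq_int // lt_neqAle; apply/andP; split; last first.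
  rewrite /approx_err numq_int denq_int mulr1 ler_norml.
  by move: p2; rewrite rmorphD /=; lra.
(* An error of exactly 1/2 would make [alpha * 2] an integer. *)
apply/eqP; rewrite /approx_err numq_int denq_int mulr1 => E.
have : exists z : int, z%:~R = alpha * 2%:~R.
  move: E; case: ger0P => _ E.
    by exists (2 * p - 1); rewrite rmorphB rmorphM /=; lra.
  by exists (2 * p + 1); rewrite rmorphD rmorphM /=; lra.
by case=> z /irrational_intM.
Qed.

(** Numerators over a common denominator differ by at least 1, so the two errors sum to at least
    1. *)
Lemma nearest_integer_lt x y : approx_err x < 1 / 2 ->
  denq x = denq y -> x <> y -> approx_err x < approx_err y.
Proof.
move=> x2 dd xy; rewrite ltNge; apply/negP => le.
have : `|(numq x - numq y)%:~R : R| < 1.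
  have -> : (numq x - numq y)%:~R = ((numq x)%:~R - alpha * (denq x)%:~R) -
     ((numq y)%:~R - alpha * (denq y)%:~R) :> R by rewrite dd rmorphB /=; ring.
  by apply: (le_lt_trans (ler_normB _ _)); rewrite -!/(approx_err _); lra.
have [nn|nn] := eqVneq (numq x - numq y) 0.
  by case: xy; apply: rat_ext => //; lia.
by have := one_le_normz nn; lra.
Qed.

Lemma approx_err_lattice (p q : int) : q != 0 ->
  exists x, approx_err x <= `|p%:~R - alpha * q%:~R|.
Proof.
move=> /(@lattice_multiple p)[k [x [k0 -> ->]]]; exists x.
rewrite !rmorphM /= mulrCA -mulrBr normrM -/(approx_err x).
by rewrite ler_peMl ?approx_err_ge0 // one_le_normz.
Qed.

(* One step of the Euclidean algorithm applied to 1 and the error. *)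
Lemma approx_err_decr x : exists y, approx_err y < approx_err x.
Proof.
have [x1|x1] := leP 1 (approx_err x).
  by have [y _ y2] := nearest_integer; exists y; lra.
pose th : R := (numq x)%:~R - alpha * (denq x)%:~R.
have eE : approx_err x = `|th| by [].
have e0 := approx_err_gt0 x; set e := approx_err x in x1 eE e0 *.
pose k := Num.floor e^-1.
have /andP[k1 k2] := floor_itv e^-1; rewrite -/k in k1 k2.
have {k1}k1 : k%:~R * e <= 1 by rewrite -ler_pdivlMr // div1r.
have {k2}k2 : 1 - k%:~R * e < e.
  by move: k2; rewrite -[e^-1]div1r ltr_pdivrMr // rmorphD /=; lra.
have k0 : 0 < k.
  by rewrite floor_gt0 -[e^-1]div1r ler_pdivlMr // mul1r ltW.
pose s : int := if 0 <= th then 1 else -1.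
have sE : s%:~R * e = th.
  rewrite eE /s; case: ger0P => _; rewrite ?mul1r ?mulN1r ?opprK //.
(* This vector has signed error [s * (k * e - 1)], and [0 <= 1 - k * e < e] by the choice of [k]. *)
have [|y yle] := @approx_err_lattice (k * numq x - s) (k * denq x).
  by rewrite mulf_neq0 ?denq_neq0 // gt_eqF.
exists y; apply: (le_lt_trans yle).
have -> : (k * numq x - s)%:~R - alpha * (k * denq x)%:~R =
    s%:~R * (k%:~R * e - 1) :> R.
  by rewrite mulrBr mulrCA sE rmorphB !rmorphM /= /th; ring.
rewrite normrM (_ : `|s%:~R| = 1) ?mul1r; last first.
  by rewrite /s; case: ifP; rewrite ?normrN normr1.
by rewrite ler0_norm; lra.
Qed.

End Irrational.

(** * Best approximations *)

Section BestApproximation.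
Variables (R : realType) (F : R -> R -> R) (alpha : R).
Hypotheses (hF : strongly_symmetric_norm F) (halpha : irrational alpha).

Local Notation err := (approx_err alpha).
Local Notation best := (best_approximation F alpha).

(* [t * F_t] depends on [t] only through [T = t ^ 2]. *)
Definition approx_norm (T : R) (x : rat) : R := F (denq x)%:~R (T * err x).

Local Notation N := approx_norm.

Lemma approx_sizeE t x : 0 < t -> approx_size F alpha t x = t^-1 * N (t ^+ 2) x.
Proof.
move=> t0; rewrite -(ssnormZ_ge0 hF) ?invr_ge0 ?(ltW t0) //.
rewrite /approx_size /scaled_norm (ssnorm_abs hF) [RHS](ssnorm_abs hF).
congr F; rewrite mulrA expr2 mulKf ?gt_eqF // normrM [RHS]normrM.
by rewrite (ger0_norm (approx_err_ge0 _ _)).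
Qed.

Lemma best_approximationP x :
  best x <-> exists2 T, 1 < T & forall y, y <> x -> N T x < N T y.
Proof.
split=> [[t [t1 h]]|[T T1 h]].
  have t0 : 0 < t by lra.
  exists (t ^+ 2) => [|y /h]; first by rewrite expr2; nra.
  by rewrite !approx_sizeE // ltr_pM2l ?invr_gt0.
have T0 : 0 <= T by lra.
exists (Num.sqrt T).
have t1 : 1 < Num.sqrt T by rewrite -[ltLHS]sqrtr1 ltr_sqrt; lra.
split=> // y /h; rewrite !approx_sizeE ?(lt_trans ltr01) //.
by rewrite sqr_sqrtr // ltr_pM2l // invr_gt0 (lt_trans ltr01).
Qed.

Lemma denqR_gt0 (x : rat) : 0 < (denq x)%:~R :> R.
Proof. by rewrite ltr0z denq_gt0. Qed.

Lemma approx_norm_ge_den T x : (denq x)%:~R <= N T x.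
Proof.
apply: le_trans (ssnorm_ge_x hF _ _).
by rewrite ger0_norm // ltW // denqR_gt0.
Qed.

Lemma approx_norm_ge_err T x : 0 <= T -> T * err x <= N T x.
Proof.
move=> T0; apply: le_trans (ssnorm_ge_y hF _ _).
by rewrite ger0_norm // mulr_ge0 // approx_err_ge0.
Qed.

Lemma approx_norm_le_add T x : 0 <= T -> N T x <= (denq x)%:~R + T * err x.
Proof.
move=> T0; apply: (le_trans (ssnorm_le_add hF _ _)).
by rewrite !ger0_norm ?mulr_ge0 ?approx_err_ge0 // ltW // denqR_gt0.
Qed.

Lemma approx_norm_le T x y : 0 <= T -> denq x <= denq y -> err x <= err y ->
  N T x <= N T y.
Proof.
move=> T0 dd ee; apply: (@le_trans _ _ (F (denq x)%:~R (T * err y))).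
  by apply: (ssnorm_ler hF); rewrite !ger0_norm ?ler_wpM2l ?mulr_ge0 ?approx_err_ge0.
by apply: (ssnorm_lel hF); rewrite !ger0_norm ?ler_int // ltW // denqR_gt0.
Qed.

Lemma approx_norm_lt T x y : 0 < T -> denq x < denq y -> err x < err y ->
  N T x < N T y.
Proof.
move=> T0 dd ee; apply: (ssnorm_lt hF); rewrite ?ltr_int ?ltr_pM2l //.
  by rewrite ltW // denqR_gt0.
by rewrite mulr_ge0 ?approx_err_ge0 // ltW.
Qed.

Lemma approx_norm_crossing T S u w : 0 < T -> T < S ->
  denq u < denq w -> err w < err u -> N T w <= N T u -> N S w < N S u.
Proof.
move=> T0 TS dd ee; apply: (ssnorm_crossing hF) => //.
- by rewrite ltW // denqR_gt0.
- by rewrite ltr_int.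
- exact: approx_err_gt0.
Qed.

(** The norm bounds the denominator and the error, hence also the numerator. The set therefore lies
    in the image under [f] of a finite box, with numerators shifted by [n] to become ordinals. *)
Lemma finite_approx_norm_le T C : 0 < T -> finite_set [set x | N T x <= C].
Proof.
move=> T0; pose B := C / T + `|alpha| * C + C.
pose n := Num.bound B.
pose f (u : 'I_(n.*2.+1) * 'I_n.+1) : rat :=
  ((u.1 : nat)%:Z - n%:Z)%:~R / ((u.2 : nat)%:Z)%:~R.
have := finite_image f (@finite_finset _ [set: 'I_(n.*2.+1) * 'I_n.+1]).
apply: sub_finite_set => x /= NC.
have C0 : 0 < C.
  apply: lt_le_trans NC; apply: lt_le_trans (approx_norm_ge_den _ _).
  exact: denqR_gt0.
have CT : 0 < C / T by rewrite divr_gt0.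
have aC : 0 <= `|alpha| * C by rewrite mulr_ge0 // ltW.
have Bn : B < n%:R by apply: archi_boundP; rewrite /B; lra.
have dC : (denq x)%:~R <= C by apply: le_trans NC; apply: approx_norm_ge_den.
have eC : err x <= C / T.
  rewrite ler_pdivlMr // mulrC; apply: le_trans NC.
  by apply: approx_norm_ge_err; apply: ltW.
have nB : `|(numq x)%:~R : R| <= B.
  have -> : (numq x)%:~R = ((numq x)%:~R - alpha * (denq x)%:~R) +
      alpha * (denq x)%:~R :> R by ring.
  apply: (le_trans (ler_normD _ _)); rewrite -/(err x) normrM.
  rewrite (@ger0_norm _ (denq x)%:~R) ?(ltW (denqR_gt0 _)) //.
  have : `|alpha| * (denq x)%:~R <= `|alpha| * C by rewrite ler_wpM2l.
  by rewrite /B; lra.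
have nn : `|numq x| < n.
  rewrite -(ltr_int R) intr_norm; apply: le_lt_trans nB _.
  by rewrite -pmulrn.
have dn : denq x < n.
  rewrite -(ltr_int R); apply: le_lt_trans dC _.
  by rewrite -pmulrn; move: Bn; rewrite /B; lra.
have d0 := denq_gt0 x.
have h1 : (absz (numq x + n%:Z)%R < n.*2.+1)%N by lia.
have h2 : (absz (denq x) < n.+1)%N by lia.
exists (Ordinal h1, Ordinal h2) => //; rewrite /f /=.
have -> : (absz (numq x + n%:Z)%R)%:Z - n%:Z = numq x by lia.
have -> : (absz (denq x))%:Z = denq x by lia.
exact: divq_num_den.
Qed.

(** Ties for the norm are broken by the error, which selects the vector that remains shortest just
    after [T]. *)
Lemma approx_norm_min T : 0 < T -> exists2 u,
  forall x, N T u <= N T x & forall x, N T x <= N T u -> err u <= err x.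
Proof.
move=> T0.
have [||v /= _ vmin] := @finite_argmin R _ [set x | N T x <= N T 0] (N T).
- exact: finite_approx_norm_le.
- by exists 0 => /=.
have {}vmin x : N T v <= N T x.
  have [/vmin//|/ltW] := leP (N T x) (N T 0).
  by apply: le_trans; apply: vmin => /=.
have [||u /= uv umin] := @finite_argmin R _ [set x | N T x <= N T v] err.
- exact: finite_approx_norm_le.
- by exists v => /=.
exists u => x; first exact: le_trans uv (vmin x).
by move=> xu; apply: umin; apply: le_trans xu uv.
Qed.

Lemma approx_norm_gap T l : 0 < T ->
  exists2 m, l < m & forall x, l < N T x -> m <= N T x.
Proof.
move=> T0; pose A := [set x | N T x <= l + 1 /\ l < N T x].
have finA : finite_set A.
  by apply: sub_finite_set (@finite_approx_norm_le T (l + 1) T0) => x [].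
have [A0|/set0P A0] := eqVneq A set0.
  exists (l + 1) => [|x lx]; first by lra.
  rewrite leNgt; apply/negP => xl.
  have : A x by split=> //; apply: ltW.
  by rewrite A0.
have [u [ul lu] umin] := finite_argmin (N T) finA A0.
exists (N T u) => // x lx; have [xl|xl] := leP (N T x) (l + 1).
  exact: umin.
by apply: le_trans ul (ltW xl).
Qed.

Lemma nearest_integer_best x : denq x = 1 -> err x < 1 / 2 -> best x.
Proof.
move=> x1 x2; apply/best_approximationP.
have d0 := approx_err_gt0 halpha x.
(* The size 3/2 is below 2, so larger denominators lose, and above 1, so [F 1] is not flat there and
   other integers lose strictly. Also [F 1 u <= 1 + u] gives [u >= 1 / 2 > err x], hence a parameter
   above 1. *)
have [||||u [u0 _ Fu]] := @lipschitz_IVT R (F 1) 1 0 2 (3 / 2).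
- by move=> y y'; rewrite mul1r; apply: ssnorm_lipschitzr.
- by [].
- by rewrite (ssnorm_x0 hF) normr1; lra.
- by have := ssnorm_ge_y hF 1 2; rewrite ger0_norm; lra.
have u2 : 1 / 2 <= u.
  by have := ssnorm_le_add hF 1 u; rewrite Fu normr1 ger0_norm //; lra.
have T1 : 1 < u / err x by rewrite ltr_pdivlMr //; lra.
exists (u / err x) => // y yx.
have Nx : N (u / err x) x = 3 / 2.
  by rewrite /N x1 divfK ?gt_eqF.
have [y1|y1] := eqVneq (denq y) 1; last first.
  have := approx_norm_ge_den (u / err x) y.
  have : (2%:~R : R) <= (denq y)%:~R by rewrite ler_int; have := denq_gt0 y; lia.
  by rewrite Nx /=; lra.
have ee : err x < err y by apply: nearest_integer_lt; rewrite ?x1 ?y1 //; apply/nesym.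
rewrite ltNge; apply/negP; rewrite Nx /N y1 => le.
have := @ssnorm_flatr _ _ hF 1 u (u / err x * err y) u0.
rewrite Fu normr1 => /(_ _ le); rewrite -[ltLHS](@divfK _ (err x)) ?gt_eqF //.
by rewrite ltr_pM2l; [move=> /(_ ee); lra | lra].
Qed.

(** Increasing [T] slightly breaks all ties in favour of the smallest error, while the gap above the
    minimum keeps the other vectors longer. *)
Lemma approx_minimiser_best T u : 1 <= T -> (forall x, N T u <= N T x) ->
  (forall x, N T x <= N T u -> err u <= err x) -> best u.
Proof.
move=> T1 uN ue; have T0 : 0 < T by lra.
have [x0 d0 e0] := nearest_integer halpha.
have [u1|u1] := eqVneq (denq u) 1.
  have [->|xu] := pselect (u = x0); first exact: nearest_integer_best.
  have lt : err x0 < err u.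
    by apply: nearest_integer_lt; rewrite ?d0 ?u1 //; apply/nesym.
  suff : err u <= err x0 by rewrite leNgt lt.
  by apply: ue; apply: approx_norm_le; rewrite ?d0 ?u1 // ltW.
have {}u1 : 1 < denq u by have := denq_gt0 u; lia.
have [m lm mN] := approx_norm_gap (N T u) T0.
have eu := approx_err_gt0 halpha u.
(* By the Lipschitz bound, [u] uses up at most half of the gap between [T] and [S]. *)
pose S := T + (m - N T u) / (2 * err u).
have TS : T < S by rewrite /S ltrDl divr_gt0 ?mulr_gt0 //; lra.
apply/best_approximationP; exists S; first by lra.
move=> x xu.
have [le|gt] := leP (N T x) (N T u); last first.
  have h1 : N S u <= N T u + (m - N T u) / 2.
    have := ssnorm_lipschitzr hF (denq u)%:~R (S * err u) (T * err u).
    have -> : S * err u - T * err u = (m - N T u) / 2.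
      by rewrite /S; field; rewrite gt_eqF.
    move=> /(le_trans (ler_norm _)); rewrite -!/(N _ _) ger0_norm; lra.
  have h2 : N T x <= N S x.
    apply: (ssnorm_ler hF); rewrite !ger0_norm ?mulr_ge0 ?(ltW T0) ?approx_err_ge0 //.
      by rewrite ler_wpM2r ?approx_err_ge0 // ltW.
    by lra.
  by have := mN _ gt; lra.
have lt : err u < err x.
  rewrite lt_neqAle ue // andbT; apply/eqP => /(approx_err_inj halpha) E.
  exact: xu.
have [dd|dd|dd] := ltgtP (denq x) (denq u).
- exact: approx_norm_crossing (uN x).
- by have := approx_norm_lt T0 dd lt; lra.
(* With equal denominators, [u] having the smaller error makes [err x] at least 1/2, so the nearest
   integer [x0] beats [x] in both coordinates and contradicts minimality. *)
- have x2 : err x0 < err x.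
    rewrite ltNge; apply/negP => le0.
    have : err x < err u by apply: nearest_integer_lt => //; lra.
    by lra.
  have := @approx_norm_lt T x0 x T0; rewrite d0 dd => /(_ u1 x2).
  by have := uN x0; lra.
Qed.

Lemma best_lt x y : best y -> denq x < denq y -> err y < err x.
Proof.
move=> /best_approximationP[T T1 h] dd; rewrite ltNge; apply/negP => ee.
have xy : x <> y by move=> E; rewrite E ltxx in dd.
have := h _ xy; rewrite ltNge approx_norm_le //; lra.
Qed.

Lemma best_denq_inj x y : best x -> best y -> denq x = denq y -> x = y.
Proof.
move=> /best_approximationP[T T1 h] /best_approximationP[T' T'1 h'] dd.
apply: contrapT => xy; have yx := nesym xy.
have [ee|ee] := leP (err x) (err y).
  by have := h' _ xy; rewrite ltNge approx_norm_le ?dd //; lra.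
by have := h _ yx; rewrite ltNge approx_norm_le ?dd ?(ltW ee) //; lra.
Qed.

(** For a vector [z] of smaller error than [x] and [T] large, the minimiser [u] satisfies
    [T * err u <= N T u <= N T z < T * err x]. *)
Lemma best_unbounded x : exists2 y, best y & err y < err x.
Proof.
have [z zx] := approx_err_decr halpha x.
pose T := 1 + (denq z)%:~R / (err x - err z).
have T1 : 1 <= T.
  by rewrite lerDl divr_ge0 ?(ltW (denqR_gt0 _)) // subr_ge0 ltW.
have [u uN ue] := @approx_norm_min T (lt_le_trans ltr01 T1).
exists u; first exact: approx_minimiser_best T1 uN ue.
have T0 : 0 <= T by lra.
have lt : (denq z)%:~R < T * (err x - err z).
  by rewrite /T mulrDl mul1r divfK ?gt_eqF //; lra.
have := uN z; have := approx_norm_ge_err u T0; have := approx_norm_le_add z T0.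
move=> h1 h2 h3; rewrite -(@ltr_pM2l _ T); lra.
Qed.

Definition consecutive_best (v w : rat) : Prop :=
  [/\ best v, best w, denq v < denq w &
      forall u, best u -> denq v < denq u -> denq w <= denq u].

Lemma exists_next_best v : best v -> exists w, consecutive_best v w.
Proof.
move=> bv; have [y by_ ey] := best_unbounded v.
have dy : denq v < denq y.
  rewrite ltNge le_eqVlt; apply/negP => /predU1P[dd|dd].
    by rewrite (best_denq_inj by_ bv dd) ltxx in ey.
  by have := best_lt bv dd; lra.
pose P n := `[< exists u, [/\ best u, denq v < denq u & denq u = n%:Z] >].
have exP : exists n, P n.
  exists `|denq y|%N; apply/asboolP; exists y; split=> //.
  by rewrite gez0_abs // ltW // denq_gt0.
case: (ex_minnP exP) => n /asboolP[w [bw vw wn]] nmin.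
exists w; split=> // u bu vu.
have : P `|denq u|%N.
  apply/asboolP; exists u; split=> //.
  by rewrite gez0_abs // ltW // denq_gt0.
by move=> /nmin; have := denq_gt0 u; lia.
Qed.

End BestApproximation.

(** * Consecutive best approximations *)

Lemma centered_remainder (C D : int) : D != 0 ->
  exists k : int, 2 * `|C - D * k| <= `|D|.
Proof.
move=> D0; have E := divz_eq C D; have r0 := modz_ge0 C D0.
have r1 := ltz_mod C D0; set r := (C %% D)%Z in E r0 r1.
have Er : C - D * (C %/ D)%Z = r by rewrite {1}E; ring.
have [h|h] := leP (2 * r) `|D|; first by exists (C %/ D)%Z; rewrite Er; lia.
exists ((C %/ D)%Z + Num.sg D).
have -> : C - D * ((C %/ D)%Z + Num.sg D) = r - `|D|.
  by rewrite mulrDr opprD addrA Er normrEsg [D * _]mulrC.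
lia.
Qed.

Section ConsecutiveBest.
Variables (R : realType) (F : R -> R -> R) (alpha : R).
Hypotheses (hF : strongly_symmetric_norm F) (halpha : irrational alpha).

Local Notation err := (approx_err alpha).
Local Notation best := (best_approximation F alpha).
Local Notation N := (approx_norm F alpha).

(** Between parameters where [v] and [w] win, the intermediate value theorem gives a tie. A shorter
    vector there would yield a best [u]; crossing from [Tv] excludes denominators below that of [v],
    crossing to [Tw] those above that of [w], and consecutiveness those between. *)
Lemma consecutive_best_tie v w : consecutive_best F alpha v w ->
  exists T, [/\ 1 < T, N T v = N T w & forall x, N T v <= N T x].
Proof.
move=> [bv bw vw next]; have ee := best_lt hF bw vw.
have wv : w <> v by move=> E; rewrite E ltxx in vw.
have [Tv Tv1 hv] := (best_approximationP alpha hF _).1 bv.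
have [Tw Tw1 hw] := (best_approximationP alpha hF _).1 bw.
have lt1 := hv _ wv; have lt2 := hw _ (nesym wv).
have Tvw : Tv < Tw.
  rewrite ltNge le_eqVlt; apply/negP => /predU1P[E|TT].
    by move: lt2; rewrite E => /(lt_trans lt1); rewrite ltxx.
  have := approx_norm_crossing hF halpha _ TT vw ee (ltW lt2); lra.
have [||||T [TvT TTw tie]] := @lipschitz_IVT R (fun T => N T v - N T w)
    (err v + err w) Tv Tw 0.
- move=> x y; have -> : N x v - N x w - (N y v - N y w) =
    (N x v - N y v) - (N x w - N y w) by ring.
  apply: (le_trans (ler_normB _ _)); rewrite mulrDl.
  have h z : `|N x z - N y z| <= err z * `|x - y|.
    apply: (le_trans (ssnorm_lipschitzr hF _ _ _)).
    by rewrite -mulrBl normrM mulrC (ger0_norm (approx_err_ge0 _ _)).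
  exact: lerD.
- exact: ltW.
- by lra.
- by lra.
have {}tie : N T v = N T w by lra.
have {}TvT : Tv < T.
  by rewrite lt_neqAle TvT andbT; apply/eqP => E; rewrite E tie ltxx in lt1.
have {}TTw : T < Tw.
  by rewrite lt_neqAle TTw andbT; apply/eqP => E; rewrite -E tie ltxx in lt2.
exists T; split=> //; first by lra.
have [u uN ue] := @approx_norm_min _ _ alpha hF T ltac:(lra).
suff vu : N T v <= N T u by move=> x; apply: le_trans (uN x).
rewrite leNgt; apply/negP => uv.
have bu : best u by apply: (approx_minimiser_best hF halpha _ uN ue); lra.
have uv' : u <> v by move=> E; rewrite E ltxx in uv.
have uw' : u <> w by move=> E; rewrite E tie ltxx in uv.
have [h|h|/(best_denq_inj hF bu bv)//] := ltgtP (denq u) (denq v).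
  have eu := best_lt hF bv h.
  have := approx_norm_crossing hF halpha _ TvT h eu (ltW (hv _ uv')).
  by lra.
have := next _ bu h; rewrite le_eqVlt.
move=> /predU1P[/esym /(best_denq_inj hF bu bw)//|h'].
have eu := best_lt hF bu h'.
have := approx_norm_crossing hF halpha _ TTw h' eu.
by have := hw _ uw'; rewrite -tie; lra.
Qed.

Lemma approx_normE T x :
  N T x = F (denq x)%:~R (T * ((numq x)%:~R - alpha * (denq x)%:~R)).
Proof.
rewrite /approx_norm (ssnorm_abs hF) [RHS](ssnorm_abs hF) normrM.
by rewrite (ger0_norm (approx_err_ge0 _ _)) [in RHS]normrM.
Qed.

(* The vectors with [q = 0] are not rational approximations; they are long
   because [l >= 2] forces the nearest integer to have size less than [T]. *)
Lemma lattice_norm_ge T l (p q : int) : 1 < T -> 2 <= l ->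
  (forall x, l <= N T x) -> (p != 0) || (q != 0) ->
  l <= F q%:~R (T * (p%:~R - alpha * q%:~R)).
Proof.
move=> T1 l2 lN; have [->|q0] := eqVneq q 0; last first.
  move=> _; have [k [x [k0 -> ->]]] := @lattice_multiple p q q0.
  have -> : T * ((k * numq x)%:~R - alpha * (k * denq x)%:~R) =
      k%:~R * (T * ((numq x)%:~R - alpha * (denq x)%:~R)) :> R.
    by rewrite !rmorphM /=; ring.
  rewrite rmorphM /= (ssnormZ hF) -approx_normE.
  apply: (le_trans (lN x)); rewrite ler_peMl ?one_le_normz //.
  by have := lN x; lra.
rewrite orbF => p0; rewrite mulr0 subr0 (ssnorm_0y hF) normrM.
have [x x1 x2] := nearest_integer halpha.
have T0 : 0 <= T by lra.
have := lN x; have := approx_norm_le_add alpha hF x T0; rewrite x1 => h1 h2.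
have e0 := approx_err_gt0 halpha x.
have := @one_le_normz R _ p0; rewrite (ger0_norm T0) => p1.
have : T * err x <= T / 2 by rewrite ler_wpM2l //; lra.
have : T <= T * `|p%:~R| by rewrite ler_peMr.
lra.
Qed.

(** Both vectors are shortest, of size [l], at the tie. Some lattice vector [u] satisfies
    [D * u = w - c * v] with [2 * |c| <= |D|], so [|D| <= 1 + |c|] and [|D|] is at most 2. *)
Lemma consecutive_best_det v w : consecutive_best F alpha v w ->
  `|denq v * numq w - denq w * numq v| = 1.
Proof.
move=> cvw; have [T [T1 tie lN]] := consecutive_best_tie cvw.
case: cvw => bv bw vw _; have ee := best_lt hF bw vw.
set l := N T v in tie lN.
have dv0 := denq_gt0 v.
have l2 : 2 <= l.
  rewrite tie; apply: le_trans (approx_norm_ge_den alpha hF T w).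
  by rewrite -[2]/(2%:~R) ler_int; lia.
pose L (q p : int) := F q%:~R (T * (p%:~R - alpha * q%:~R)).
have Lv : L (denq v) (numq v) = l by rewrite /L -approx_normE.
have Lw : L (denq w) (numq w) = l by rewrite /L -approx_normE.
have LZ (k q p : int) : L (k * q) (k * p) = `|k%:~R| * L q p.
  by rewrite /L -(ssnormZ hF) !rmorphM /=; congr F; ring.
have LD q p q' p' : L (q + q') (p + p') <= L q p + L q' p'.
  have := ssnormD hF q%:~R (T * (p%:~R - alpha * q%:~R)) q'%:~R
    (T * (p'%:~R - alpha * q'%:~R)).
  rewrite /L !rmorphD /=; congr (F _ _ <= _); ring.
have Lge q p : (p != 0) || (q != 0) -> l <= L q p by apply: lattice_norm_ge.
set D := _ - _.
have D0 : D != 0.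
  apply/eqP => D0; suff E : v = w by rewrite E ltxx in vw.
  rewrite -(divq_num_den v) -(divq_num_den w); apply/eqP.
  rewrite eqr_div ?intr_eq0 ?denq_neq0 // -!rmorphM /= eqr_int.
  by apply/eqP; move: D0; rewrite /D; lia.
have [b [a ab]] := Bezoutz (numq v) (denq v).
have {}ab : b * numq v + a * denq v = 1.
  by rewrite ab; apply/eqP; rewrite -[_ == _]/(coprimez _ _) coprimezE coprime_num_den.
(* In coordinates (denominator, numerator), [v] and [(-b, a)] form a basis of the lattice and
   [w = C * v + D * (-b, a)]; subtracting [D * k] copies of [v] centers the coefficient. *)
pose C := denq w * a + numq w * b.
have [k kc] := @centered_remainder C D D0; set c := C - D * k in kc.
pose uq := k * denq v - b; pose up := k * numq v + a.
have Eq : D * uq = denq w + - c * denq v.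
  by rewrite -[denq w]mulr1 -ab /c /C /D /uq; ring.
have Ep : D * up = numq w + - c * numq v.
  by rewrite -[numq w]mulr1 -ab /c /C /D /up; ring.
have det1 : denq v * up - uq * numq v = 1 by rewrite -ab /up /uq; ring.
have u0 : (up != 0) || (uq != 0).
  apply/negPn/negP; rewrite negb_or !negbK => /andP[/eqP E1 /eqP E2].
  by move: det1; rewrite E1 E2 mulr0 mul0r.
have leD : `|D| <= 1 + `|c|.
  rewrite -(ler_int R) rmorphD /= !intr_norm.
  have := LD (denq w) (numq w) (- c * denq v) (- c * numq v).
  rewrite -Eq -Ep !LZ Lv Lw rmorphN normrN => h.
  have := Lge _ _ u0; have := normr_ge0 (D%:~R : R).
  move: h; set x := `|D%:~R|; set y := `|c%:~R| => h x0 lu.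
  have : x * l <= (1 + y) * l by apply: le_trans (ler_wpM2l x0 lu) _; lra.
  by rewrite ler_pM2r //; lra.
have {leD} [D1|[D2 c1]] : `|D| = 1 \/ `|D| = 2 /\ `|c| = 1 by lia.
  by [].
(* With [D] even and [c] odd, [w - v] is twice a lattice vector, and so is [w + v];
   [ssnorm_half_sum_lt] then makes one half shorter than [l]. *)
have [mq [mp [mqE mpE]]] : exists mq mp : int,
    denq w - denq v = 2 * mq /\ numq w - numq v = 2 * mp.
  move: Eq Ep.
  have [->|->] : c = 1 \/ c = -1 by lia.
    have [->|->] : D = 2 \/ D = -2 by lia.
      by exists uq, up; lia.
    by exists (- uq), (- up); lia.
  have [->|->] : D = 2 \/ D = -2 by lia.
    by exists (uq - denq v), (up - numq v); lia.
  by exists (- uq - denq v), (- up - numq v); lia.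
exfalso.
pose thv : R := (numq v)%:~R - alpha * (denq v)%:~R.
pose thw : R := (numq w)%:~R - alpha * (denq w)%:~R.
have mqR : mq%:~R = ((denq w)%:~R - (denq v)%:~R) / 2 :> R.
  by rewrite -rmorphB mqE rmorphM /=; field.
have mpR : mp%:~R = ((numq w)%:~R - (numq v)%:~R) / 2 :> R.
  by rewrite -rmorphB mpE rmorphM /=; field.
have T0 : 0 < T by lra.
have vwR : (denq v)%:~R < (denq w)%:~R :> R by rewrite ltr_int.
have ee' : `|T * thw| < `|T * thv|.
  by rewrite !normrM ltr_pM2l // normr_gt0 gt_eqF.
have nz : T * thw != 0.
  rewrite mulf_neq0 ?(gt_eqF T0) //.
  by apply: approx_signed_neq0 => //; apply: denq_neq0.
have := @ssnorm_half_sum_lt R F hF _ _ _ _ l (denqR_gt0 _ _) vwR nz ee' Lv Lw.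
have m0 : mq != 0 by apply/eqP; lia.
have m1 : mq + denq v != 0 by apply/eqP; lia.
have := Lge mq mp; rewrite m0 orbT => /(_ isT).
have := Lge (mq + denq v) (mp + numq v); rewrite m1 orbT => /(_ isT).
rewrite /L !rmorphD /= mqR mpR => h1 h2.
have -> : (T * thw - T * thv) / 2 = T * (((numq w)%:~R - (numq v)%:~R) / 2 -
   alpha * (((denq w)%:~R - (denq v)%:~R) / 2)) by rewrite /thv /thw; field.
move=> /(_ h2).
have -> : (T * thw + T * thv) / 2 =
   T * (((numq w)%:~R - (numq v)%:~R) / 2 + (numq v)%:~R -
   alpha * (((denq w)%:~R - (denq v)%:~R) / 2 + (denq v)%:~R)).
  by rewrite /thv /thw; field.
have -> : ((denq w)%:~R + (denq v)%:~R) / 2 =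
  ((denq w)%:~R - (denq v)%:~R) / 2 + (denq v)%:~R :> R by field.
lra.
Qed.

End ConsecutiveBest.

(** * Convergents of semi-regular continued fractions *)

(* Indices are shifted by one: [cf_P c m.+1] and [cf_Q c m.+1] are p_m and q_m,
   starting from p_(-1) = 1 and q_(-1) = 0. *)
Fixpoint continuant (c : cfrac) (u0 u1 : int) (n : nat) : int :=
  if n is n'.+1 then
    if n' is m.+1 then
      cf_den c n' * continuant c u0 u1 n' + cf_num c m * continuant c u0 u1 m
    else u1
  else u0.

Definition cf_P (c : cfrac) : nat -> int := continuant c 1 (cf_den c 0).
Definition cf_Q (c : cfrac) : nat -> int := continuant c 0 1.

Lemma continuantSS c u0 u1 n : continuant c u0 u1 n.+2 =
  cf_den c n.+1 * continuant c u0 u1 n.+1 + cf_num c n * continuant c u0 u1 n.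
Proof. by []. Qed.

(** The last entry is left as a variable [y], so that adding a level is a substitution for [y]. *)
Fixpoint cf_tail (c : cfrac) (k n : nat) (y : rat) : rat :=
  if n is n'.+1 then (cf_den c k)%:~R + (cf_num c k)%:~R / cf_tail c k.+1 n' y
  else y.

Lemma cf_segmentE c k n : cf_segment c k n = cf_tail c k n (cf_den c (k + n))%:~R.
Proof.
elim: n k => [|n IH] k /=; first by rewrite addn0.
by rewrite IH addSnnS.
Qed.

Lemma cf_tail_rcons c k n y : cf_tail c k n.+1 y =
  cf_tail c k n ((cf_den c (k + n))%:~R + (cf_num c (k + n))%:~R / y).
Proof.
elim: n k => [|n IH] k; first by rewrite addn0.
by rewrite -addSnnS [RHS]/= -IH.
Qed.

Section SemiRegular.
Variable c : cfrac.
Hypothesis hc : semi_regular c.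

Lemma cf_numP m : cf_num c m = 1 \/ cf_num c m = -1.
Proof. by case: hc. Qed.

Lemma cf_step_ge1 (k : nat) (y : rat) : (0 < k)%N -> 1 <= y ->
  1 <= (cf_den c k)%:~R + (cf_num c k)%:~R / y.
Proof.
case: hc => den0 _ sum1 _ k0 y1.
have y0 : 0 < y by lra.
have yV : 0 < y^-1 by rewrite invr_gt0.
have yV1 : y^-1 <= 1 by rewrite invf_le1.
have := den0 k k0; have := sum1 k k0.
have [->|->] := cf_numP k => h1 h2.
  have : (1%:~R : rat) <= (cf_den c k)%:~R by rewrite ler_int; lia.
  by rewrite /= mul1r; lra.
have : (2%:~R : rat) <= (cf_den c k)%:~R by rewrite ler_int; lia.
by rewrite rmorphN /= mulN1r; lra.
Qed.

Lemma cf_denR_ge1 k : (0 < k)%N -> 1 <= (cf_den c k)%:~R :> rat.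
Proof.
case: hc => den0 _ _ _ k0; rewrite -[1]/(1%:~R) ler_int.
by have := den0 k k0; lia.
Qed.

Lemma cf_segment_ge1 k n : (0 < k)%N -> 1 <= cf_segment c k n.
Proof.
elim: n k => [|n IH] k k0 /=; first exact: cf_denR_ge1.
by apply: cf_step_ge1 => //; apply: IH.
Qed.

(** The second conjunct carries the induction: with [z] the term [cf_num c n * cf_Q c n], both
    [a * Q + z] and [(a + e) * Q + z] are at least [Q + z]. *)
Lemma cf_Q_gt0_aux n : 0 < cf_Q c n.+1 /\ 0 < cf_Q c n.+1 + cf_num c n * cf_Q c n.
Proof.
elim: n => [|n [IH1 IH2]]; first by rewrite /cf_Q /=; lia.
case: hc => den0 _ sum1 _.
rewrite /cf_Q continuantSS -!/(cf_Q c _).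
have := den0 n.+1 isT; have := sum1 n.+1 isT.
move: (cf_den c n.+1) (cf_num c n.+1) (cf_num c n * cf_Q c n) IH1 IH2 => a e z.
by move: (cf_Q c n.+1) => Q; nia.
Qed.

Lemma cf_Q_gt0 n : 0 < cf_Q c n.+1.
Proof. by case: (cf_Q_gt0_aux n). Qed.

Lemma cf_det n : `|cf_P c n.+1 * cf_Q c n - cf_P c n * cf_Q c n.+1| = 1.
Proof.
elim: n => [|n IH]; first by rewrite /cf_P /cf_Q /= mulr0 mulr1.
rewrite /cf_P /cf_Q !continuantSS -!/(cf_P c _) -!/(cf_Q c _).
rewrite -[RHS]IH.
by have [->|->] := cf_numP n; [rewrite -[RHS]normrN|]; congr `|_|; ring.
Qed.

(** Each level acts on [y] as a Moebius map, and composing these maps produces the recurrence of the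
    continuants. *)
Lemma cf_tail_PQ n y : 1 <= y -> cf_tail c 0 n.+1 y =
  ((cf_P c n.+1)%:~R * y + (cf_num c n)%:~R * (cf_P c n)%:~R) /
  ((cf_Q c n.+1)%:~R * y + (cf_num c n)%:~R * (cf_Q c n)%:~R).
Proof.
elim: n y => [|n IH] y y1; have y0 : y != 0 by rewrite gt_eqF //; lra.
  rewrite /cf_P /cf_Q /=; field; rewrite ?y0 //.
rewrite cf_tail_rcons add0n IH; last exact: cf_step_ge1.
rewrite /cf_P /cf_Q !continuantSS -!/(cf_P c _) -!/(cf_Q c _) !rmorphD !rmorphM /=.
have cancel (a b : rat) : (a / y) / (b / y) = a / b.
  by rewrite invf_div mulrA divfK.
by rewrite -[RHS]cancel; congr (_ / _); field.
Qed.

Lemma convergentE m : convergent c m = (cf_P c m.+1)%:~R / (cf_Q c m.+1)%:~R.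
Proof.
rewrite /convergent cf_segmentE add0n; case: m => [|m].
  by rewrite /cf_P /cf_Q /= divr1.
rewrite cf_tail_PQ ?cf_denR_ge1 // /cf_P /cf_Q !continuantSS !rmorphD !rmorphM /=.
by congr (_ / _); ring.
Qed.

Lemma coprime_cf_PQ m : coprime `|cf_P c m.+1| `|cf_Q c m.+1|.
Proof.
rewrite -coprimezE; have := cf_det m; set D := _ - _ => D1.
apply/coprimezP; exists (D * cf_Q c m, - D * cf_P c m) => /=.
have : D * D = 1 by have [->|->] : D = 1 \/ D = -1 by lia.
by move=> <-; rewrite /D; ring.
Qed.

Lemma numq_convergent m : numq (convergent c m) = cf_P c m.+1.
Proof.
rewrite convergentE coprimeq_num ?coprime_cf_PQ // gtr0_sg ?mul1r //.
exact: cf_Q_gt0.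
Qed.

Lemma denq_convergent m : denq (convergent c m) = cf_Q c m.+1.
Proof.
have Q0 := cf_Q_gt0 m.
rewrite convergentE coprimeq_den ?coprime_cf_PQ // gt_eqF //; lia.
Qed.

End SemiRegular.

(** * Complete quotients and the decrease of the errors *)

Section ExpansionError.
Variables (R : realType) (alpha : R) (c : cfrac).
Hypotheses (halpha : irrational alpha) (hc : semi_regular c).
Hypothesis c_alpha : expansion_of c alpha.

(** The complete quotients of [alpha], obtained by solving [xi_k = a_k + e_(k+1) / xi_(k+1)] for the
    tail. *)
Fixpoint cf_complete (k : nat) : R :=
  if k is k'.+1 then (cf_num c k')%:~R / (cf_complete k' - (cf_den c k')%:~R)
  else alpha.

Lemma cf_num_neq0 k : (cf_num c k)%:~R != 0 :> R.
Proof. by rewrite intr_eq0; have [->|->] := cf_numP hc k. Qed.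

Lemma cf_complete_irrational k : irrational (cf_complete k).
Proof.
elim: k => [//|k IH] /= [r _ rE]; apply: IH.
exists ((cf_den c k)%:~R + (cf_num c k)%:~R / r) => //.
rewrite rmorphD fmorph_div /= !ratr_int rE invf_div mulrCA divff ?cf_num_neq0 //.
by rewrite mulr1 addrC subrK.
Qed.

Lemma irrational_neq_int (x : R) (z : int) : irrational x -> x - z%:~R != 0.
Proof.
move=> ix; rewrite subr_eq0; apply/eqP => xz; apply: ix.
by exists z%:~R => //; rewrite ratr_int.
Qed.

Lemma cf_complete_cvg k :
  (ratr (cf_segment c k n) : R) @[n --> \oo] --> cf_complete k.
Proof.
elim: k => [|k IH]; first exact: c_alpha.
have nz := irrational_neq_int (cf_den c k) (@cf_complete_irrational k).
have h : (cf_num c k)%:~R / (ratr (cf_segment c k n.+1) - (cf_den c k)%:~R) @[n --> \oo]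
    --> cf_complete k.+1.
  apply: cvgMl_tmp; apply: cvgV => //; apply: cvgB; last exact: cvg_cst.
  by move: IH; rewrite -(cvg_shiftS (fun n => ratr (cf_segment c k n) : R)).
apply: cvg_trans h; apply: near_eq_cvg; apply: nearW => n /=.
rewrite rmorphD fmorph_div /= !ratr_int addrAC subrr add0r.
by rewrite invf_div mulrCA divff ?mulr1 ?cf_num_neq0.
Qed.

(** A limit of segments that are at least 1 is at least 1, and irrationality excludes equality. *)
Lemma cf_complete_gt1 k : 1 < cf_complete k.+1.
Proof.
rewrite lt_neqAle; apply/andP; split.
  apply/eqP => E; apply: (@cf_complete_irrational k.+1); rewrite -E.
  by exists 1 => //; rewrite rmorph1.
have cv := @cf_complete_cvg k.+1; rewrite -(cvg_lim _ cv) //.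
apply: limr_ge; first by apply/cvg_ex; exists (cf_complete k.+1).
apply: nearW => n.
by rewrite -(rmorph1 (@ratr R)) ler_rat cf_segment_ge1.
Qed.

Definition cf_theta (n : nat) : R := (cf_P c n)%:~R - alpha * (cf_Q c n)%:~R.

(** Up to sign, the complete quotient is the ratio of consecutive signed errors; being above 1, it
    makes the errors strictly decrease. *)
Lemma cf_theta_complete n :
  cf_theta n.+1 * cf_complete n.+1 = - (cf_num c n)%:~R * cf_theta n.
Proof.
elim: n => [|n IH].
  rewrite /cf_theta /cf_P /cf_Q /= mulr1 mulr0 subr0 mulr1.
  by field; rewrite irrational_neq_int.
have nz := irrational_neq_int (cf_den c n.+1) (@cf_complete_irrational n.+1).
have -> : cf_theta n.+2 = (cf_den c n.+1)%:~R * cf_theta n.+1 +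
    (cf_num c n)%:~R * cf_theta n.
  by rewrite /cf_theta /cf_P /cf_Q !continuantSS !rmorphD !rmorphM /=; ring.
have -> : cf_complete n.+2 =
    (cf_num c n.+1)%:~R / (cf_complete n.+1 - (cf_den c n.+1)%:~R) by [].
rewrite -[(cf_num c n)%:~R]opprK mulNr -IH.
move: (cf_complete n.+1) nz => xi nz; field.
by rewrite nz.
Qed.

Lemma approx_err_convergent m : approx_err alpha (convergent c m) = `|cf_theta m.+1|.
Proof. by rewrite /approx_err numq_convergent // denq_convergent. Qed.

Lemma approx_err_convergent_lt m :
  approx_err alpha (convergent c m.+1) < approx_err alpha (convergent c m).
Proof.
have e0 := approx_err_gt0 halpha (convergent c m.+1).
rewrite !approx_err_convergent in e0 *.
have : `|cf_theta m.+2| * cf_complete m.+2 = `|cf_theta m.+1|.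
  have x0 : 0 <= cf_complete m.+2 by have := cf_complete_gt1 m.+1; lra.
  rewrite -[X in _ * X](ger0_norm x0) -normrM cf_theta_complete normrM normrN.
  by have [->|->] := cf_numP hc m.+1; rewrite ?rmorphN ?normrN normr1 mul1r.
move=> <-; rewrite ltr_pMr //; exact: cf_complete_gt1.
Qed.

Lemma approx_err_convergent_mono m n : (m < n)%N ->
  approx_err alpha (convergent c n) < approx_err alpha (convergent c m).
Proof.
elim: n => [//|n IH]; rewrite ltnS leq_eqVlt => /predU1P[->|/IH].
  exact: approx_err_convergent_lt.
exact: lt_trans (approx_err_convergent_lt n).
Qed.

End ExpansionError.

(** * Uniqueness of the expansion *)

Lemma cfrac_convergent_inj c c' : semi_regular c -> semi_regular c' ->
  (forall m, convergent c m = convergent c' m) -> c = c'.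
Proof.
move=> hc hc' E.
have sgE k : cf_segment c k 1 - cf_segment c k 0 =
    (cf_num c k)%:~R / (cf_den c k.+1)%:~R by rewrite /= addrC addKr.
have sgE' k : cf_segment c' k 1 - cf_segment c' k 0 =
    (cf_num c' k)%:~R / (cf_den c' k.+1)%:~R by rewrite /= addrC addKr.
(* The segment of length 0 gives [a_k], the sign of the next difference gives [e_(k+1)] because
   [a_(k+1) > 0], and the tails follow by cancellation. *)
have step k : (forall n, cf_segment c k n = cf_segment c' k n) ->
    [/\ cf_den c k = cf_den c' k, cf_num c k = cf_num c' k &
        forall n, cf_segment c k.+1 n = cf_segment c' k.+1 n].
  move=> h.
  have dd : cf_den c k = cf_den c' k.
    by have /eqP := h 0%N; rewrite /= eqr_int => /eqP.
  have nn : cf_num c k = cf_num c' k.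
    have := sgE k; rewrite !h sgE' => q.
    have a1 : 0 < (cf_den c k.+1)%:~R^-1 :> rat.
      by rewrite invr_gt0; have := cf_denR_ge1 hc (ltn0Sn k); lra.
    have a1' : 0 < (cf_den c' k.+1)%:~R^-1 :> rat.
      by rewrite invr_gt0; have := cf_denR_ge1 hc' (ltn0Sn k); lra.
    have [e|e] := cf_numP hc k; have [e'|e'] := cf_numP hc' k; rewrite e e' // in q *;
      exfalso; move: q; rewrite ?rmorphN /= ?mul1r ?mulN1r; lra.
  split=> // n; have := h n.+1; rewrite /= dd nn => /addrI.
  have nz : (cf_num c' k)%:~R != 0 :> rat.
    by rewrite intr_eq0; have [->|->] := cf_numP hc' k.
  by move=> /(mulfI nz) /invr_inj.
have all k n : cf_segment c k n = cf_segment c' k n.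
  by elim: k n => [|k IH]; [exact: E|have [] := step k IH].
case: c c' {hc hc' E sgE sgE'} step all => [a e] [a' e'] /= step all.
by congr CFrac; apply: funext => k; have [] := step k (all k).
Qed.

(** By strong induction [x n = y k] and [y n = x j] with [k, j >= n]; if [k > n], then [f (x n) = f
    (y k) < f (y n) = f (x j) <= f (x n)]. *)
Lemma decreasing_range_inj (R : realType) (T : Type) (f : T -> R) (x y : nat -> T) :
  (forall m n, (m < n)%N -> f (x n) < f (x m)) ->
  (forall m n, (m < n)%N -> f (y n) < f (y m)) ->
  range x = range y -> forall n, x n = y n.
Proof.
move=> dx dy xy n; elim/ltn_ind: n => n IH.
have [k _ yk] : range y (x n) by rewrite -xy; exists n.
have [j _ xj] : range x (y n) by rewrite xy; exists n.
have nk : (n <= k)%N.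
  rewrite leqNgt; apply/negP => kn; have := dx _ _ kn.
  by rewrite (IH _ kn) yk ltxx.
have nj : (n <= j)%N.
  rewrite leqNgt; apply/negP => jn; have := dy _ _ jn.
  by rewrite -(IH _ jn) xj ltxx.
move: nk; rewrite leq_eqVlt => /predU1P[nk|nk]; first by rewrite -yk nk.
have := dy _ _ nk; rewrite yk -xj.
move: nj; rewrite leq_eqVlt => /predU1P[->|/dx]; first by rewrite ltxx.
by move=> h1 /(lt_trans h1); rewrite ltxx.
Qed.

Lemma expansion_unique (R : realType) (alpha : R) (c c' : cfrac) :
  irrational alpha -> semi_regular c -> semi_regular c' ->
  expansion_of c alpha -> expansion_of c' alpha ->
  range (convergent c) = range (convergent c') -> c = c'.
Proof.
move=> halpha hc hc' ec ec' rE; apply: cfrac_convergent_inj => //.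
by apply: (decreasing_range_inj (f := approx_err alpha)) rE => m n mn;
  apply: approx_err_convergent_mono.
Qed.

(** * The expansion by best approximations *)

Section CfracOfSequence.
Variables (R : realType) (alpha : R) (P Q : nat -> int).
Hypotheses (P0 : P 0 = 1) (Q0 : Q 0 = 0) (Q1 : Q 1 = 1).
Hypothesis Q_lt : forall n, Q n < Q n.+1.

Let det n := P n.+1 * Q n - P n * Q n.+1.
Let theta n : R := (P n)%:~R - alpha * (Q n)%:~R.

Hypothesis det1 : forall n, `|det n| = 1.
Hypothesis theta_lt : forall n, `|theta n.+1| < `|theta n|.

(* The partial quotients solve [X n.+2 = a * X n.+1 + e * X n] for [X = P, Q]
   by Cramer's rule. *)
Definition cfrac_of_sequence : cfrac := CFrac
  (fun n => if n is m.+1 then det m * (P m.+2 * Q m - P m * Q m.+2) else P 1)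
  (fun n => - det n.+1 * det n).

Let c := cfrac_of_sequence.

Let det_sqr n : det n * det n = 1.
Proof. by have h := det1 n; have [->|->] : det n = 1 \/ det n = -1 by lia. Qed.

Let recP n : P n.+2 = cf_den c n.+1 * P n.+1 + cf_num c n * P n.
Proof. by rewrite -[LHS]mul1r -(det_sqr n) /= /det; ring. Qed.

Let recQ n : Q n.+2 = cf_den c n.+1 * Q n.+1 + cf_num c n * Q n.
Proof. by rewrite -[LHS]mul1r -(det_sqr n) /= /det; ring. Qed.

Let rec_theta n : theta n.+2 =
  (cf_den c n.+1)%:~R * theta n.+1 + (cf_num c n)%:~R * theta n.
Proof. by rewrite /theta recP recQ !rmorphD !rmorphM /=; ring. Qed.

Let numP n : cf_num c n = 1 \/ cf_num c n = -1.
Proof.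
have := det1 n; have := det1 n.+1; rewrite /=.
by move: (det n) (det n.+1) => x y; nia.
Qed.

Let Q_ge0 n : 0 <= Q n.
Proof. by elim: n => [|n IH]; [rewrite Q0|apply: ltW; apply: le_lt_trans (Q_lt n)]. Qed.

Let den_gt0 n : 0 < cf_den c n.+1.
Proof.
have := recQ n; have := Q_lt n; have := Q_lt n.+1; have := Q_ge0 n.
move: (cf_den c n.+1) => a; have [->|->] := numP n; nia.
Qed.

(** A violation means [a = 1] and [e = -1]. Decreasing errors force [theta n.+1] and [theta n.+2] to
    have opposite signs, so the terms of [theta n.+3 = b * theta n.+2 - theta n.+1] add up and its
    size is at least that of [theta n.+2]. *)
Let den_num_ge1 n : 1 <= cf_den c n.+1 + cf_num c n.+1.
Proof.
rewrite leNgt; apply/negP => lt1.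
have a1 := den_gt0 n; have a2 := den_gt0 n.+1.
have e : cf_num c n.+1 = -1 by case: (numP n.+1) lt1; lia.
have a : cf_den c n.+1 = 1 by lia.
have h1 := rec_theta n; have h2 := rec_theta n.+1.
rewrite a mul1r in h1; rewrite e rmorphN /= mulN1r in h2.
have t1 := theta_lt n; have t2 := theta_lt n.+1; have t3 := theta_lt n.+2.
have {a2} : 1 <= (cf_den c n.+2)%:~R :> R.
  by rewrite -[1]/(1%:~R) ler_int; lia.
move: (theta n) (theta n.+1) (theta n.+2) (theta n.+3) h1 h2 t1 t2 t3.
move: ((cf_den c n.+2)%:~R : R) => b x y z w h1 h2 t1 t2 t3 b1.
have bz : (0 <= z /\ z <= b * z) \/ (z <= 0 /\ b * z <= z).
  by have [z0|z0] := leP 0 z; [left|right]; split; nra.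
have sg : (z <= 0 /\ 0 <= y) \/ (0 <= z /\ y <= 0).
  move: h1 t1 t2; have [->|->] := numP n; rewrite ?rmorphN /= ?mul1r ?mulN1r => ->;
  case: (ger0P x); case: (ger0P y) => ? ?; case: ger0P => ? ? ?; lra.
suff : z < z by rewrite ltxx.
move: t3; rewrite h2; case: (ger0P z); case: (ger0P (b * z - y)) => ? ? ?;
  case: sg => -[? ?]; case: bz => -[? ?]; lra.
Qed.

Lemma cf_P_of_sequence n : cf_P c n = P n.
Proof.
elim/ltn_ind: n => -[_|[_|n IH]]; rewrite ?P0 //.
by rewrite /cf_P continuantSS -!/(cf_P c _) !IH // recP.
Qed.

Lemma cf_Q_of_sequence n : cf_Q c n = Q n.
Proof.
elim/ltn_ind: n => -[_|[_|n IH]]; rewrite ?Q0 ?Q1 //.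
by rewrite /cf_Q continuantSS -!/(cf_Q c _) !IH // recQ.
Qed.

(* If [a_m + e_(m+1) = 1] from some point on, then [a_m = 2] and
   [e_(m+1) = -1], so [theta] is eventually an arithmetic progression. *)
Let infinite_ge2 :
  infinite_set [set m : nat | (1 <= m)%N /\ 2 <= cf_den c m + cf_num c m].
Proof.
set A := [set _ | _] => finA.
have [M AM] : exists M, forall m, A m -> (m <= M)%N.
  have [->|/set0P A0] := eqVneq A set0; first by exists 0%N.
  have [M _ Mmax] := finite_argmin (fun n => - (n%:R : R)) finA A0.
  by exists M => m /Mmax; rewrite lerN2 ler_nat.
have step n : (M < n)%N -> theta n.+2 = 2 * theta n.+1 - theta n.
  move=> Mn; rewrite rec_theta.
  have hA m : (M < m)%N -> cf_den c m = 2 /\ cf_num c m = -1.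
    case: m => // m Mm; have := den_num_ge1 m; have := den_gt0 m.
    have : ~ (2 <= cf_den c m.+1 + cf_num c m.+1).
      move=> h; have : A m.+1 by [].
      by move=> /AM; rewrite leqNgt Mm.
    by have [->|->] := numP m.+1; lia.
  have [_ ->] := hA n Mn; have [-> _] := hA n.+1 (ltnW Mn).
  by rewrite rmorphN /= mulN1r.
pose d := theta M.+2 - theta M.+1.
have ap j : theta (M.+1 + j.+1)%N - theta (M.+1 + j)%N = d.
  elim: j => [|j IH]; first by rewrite addn0 addn1.
  by rewrite -IH !addnS step; [ring|lia].
have ap' j : theta (M.+1 + j)%N = theta M.+1 + j%:R * d.
  elim: j => [|j IH]; first by rewrite addn0 mul0r addr0.
  by have := ap j; rewrite IH -natr1; lra.
have d0 : 0 < `|d|.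
  rewrite normr_gt0 subr_eq0; apply/eqP => E.
  by have := theta_lt M.+1; rewrite E ltxx.
have bnd j : `|theta (M.+1 + j)%N| <= `|theta M.+1|.
  elim: j => [|j IH]; first by rewrite addn0.
  by rewrite addnS; apply: le_trans IH; apply: ltW.
(* After [j] steps the progression has moved by more than [2 * |theta M.+1|], although all its terms
   are bounded by [|theta M.+1|]. *)
pose j := Num.bound (2 * `|theta M.+1| / `|d|).
have : 2 * `|theta M.+1| / `|d| < j%:R.
  by apply: archi_boundP; rewrite divr_ge0 ?mulr_ge0.
rewrite ltr_pdivrMr //; apply/negP; rewrite -leNgt.
have -> : j%:R * `|d| = `|theta (M.+1 + j)%N - theta M.+1|.
  by rewrite ap' addrC addKr normrM normr_nat.
by apply: (le_trans (ler_normB _ _)); have := bnd j; lra.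
Qed.

Lemma semi_regular_cfrac_of_sequence : semi_regular c.
Proof.
by split=> //; case.
Qed.

End CfracOfSequence.

(** * Enumeration of the best approximations and existence of the expansion *)

Section Existence.
Variables (R : realType) (F : R -> R -> R) (alpha : R).
Hypotheses (hF : strongly_symmetric_norm F) (halpha : irrational alpha).

Local Notation err := (approx_err alpha).
Local Notation best := (best_approximation F alpha).

Lemma best_enumeration : exists x : nat -> rat,
  [/\ denq (x 0) = 1, err (x 0) < 1 / 2,
      forall n, consecutive_best F alpha (x n) (x n.+1) &
      forall y, best y -> exists n, x n = y].
Proof.
have [x0 d0 e0] := nearest_integer halpha.
have /choice[f fP] : forall v, exists w, best v -> consecutive_best F alpha v w.
  move=> v; have [/(exists_next_best hF halpha)[w vw]|nb] := pselect (best v).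
    by exists w.
  by exists v.
pose x n := iter n f x0.
have bx n : best (x n).
  elim: n => [|n /fP[]//]; exact: nearest_integer_best.
have cx n : consecutive_best F alpha (x n) (x n.+1) by apply: fP.
exists x; split=> // y byy.
have dn n : n%:Z < denq (x n).
  elim: n => [|n IH]; first by rewrite d0.
  by have [_ _ h _] := cx n; lia.
(* At the least [n] with [p n], consecutiveness gives the reverse inequality, and best
   approximations with equal denominators coincide. *)
pose p n := denq y <= denq (x n).
have exp : exists n, p n.
  by exists `|denq y|%N; rewrite /p; have := dn `|denq y|%N; have := denq_gt0 y; lia.
case: (ex_minnP exp) => -[|n] pn nmin; [exists 0%N|exists n.+1].
  apply: (best_denq_inj hF (bx _) byy); move: pn; rewrite /p d0.
  by have := denq_gt0 y; lia.
apply: (best_denq_inj hF (bx _) byy); apply/eqP; rewrite eq_le [X in _ && X]pn andbT.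
have [_ _ _ h] := cx n; apply: h => //; rewrite ltNge; apply/negP => /nmin.
by rewrite ltnn.
Qed.

Lemma exists_best_expansion : exists c : cfrac,
  [/\ semi_regular c, expansion_of c alpha &
      [set x | exists m, convergent c m = x] = [set x | best x]].
Proof.
have [x [d0 e0 cx xonto]] := best_enumeration.
(* Index 0 holds the vector [p_(-1) = 1], [q_(-1) = 0], of error 1, in front of the nearest
   integer. *)
pose P n : int := if n is m.+1 then numq (x m) else 1.
pose Q n : int := if n is m.+1 then denq (x m) else 0.
have Qlt n : Q n < Q n.+1.
  by case: n => [|n]; rewrite /Q ?d0 //; case: (cx n).
have det1 n : `|P n.+1 * Q n - P n * Q n.+1| = 1.
  case: n => [|n]; first by rewrite /P /Q d0 mulr0 mulr1.
  by rewrite -[RHS](consecutive_best_det hF halpha (cx n)) /P /Q; congr `|_|; ring.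
have thlt n : `|(P n.+1)%:~R - alpha * (Q n.+1)%:~R| <
    `|(P n)%:~R - alpha * (Q n)%:~R : R|.
  case: n => [|n]; rewrite -/(err _).
    by rewrite /P /Q mulr0 subr0 normr1; lra.
  by have [_ bw h _] := cx n; exact: (best_lt hF bw h).
pose c := cfrac_of_sequence P Q.
have hc : semi_regular c.
  by apply: (@semi_regular_cfrac_of_sequence R alpha).
have cE m : convergent c m = x m.
  apply: rat_ext; rewrite ?numq_convergent ?denq_convergent //.
    by rewrite cf_P_of_sequence.
  by rewrite cf_Q_of_sequence.
exists c; split=> //.
- rewrite /expansion_of; apply/cvgrPdist_lt => eps eps0.
  apply: filterS (near_infty_natSinv_lt (PosNum eps0)) => m /= m_eps.
  rewrite cE.
  have dm n : n.+1%:Z <= denq (x n).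
    elim: n => [|n IH]; first by rewrite d0.
    by have := Qlt n.+1; rewrite /Q; lia.
  have em n : err (x n) < 1.
    elim: n => [|n]; first by lra.
    by apply: lt_trans; exact: (thlt n.+1).
  have D0 := @denqR_gt0 R (x m).
  (* The distance to [alpha] is the error, less than 1, divided by a denominator that is at least
     [m + 1]. *)
  have -> : `|alpha - ratr (x m)| = err (x m) / (denq (x m))%:~R.
    rewrite -[X in _ / X](gtr0_norm D0) /approx_err -normf_div distrC.
    by congr `|_|; rewrite /ratr; field; rewrite gt_eqF.
  apply: (@le_lt_trans _ _ (m.+1%:R^-1)).
    apply: (@le_trans _ _ (1 / (denq (x m))%:~R)).
      by rewrite ler_pM2r ?invr_gt0 // ltW.
    by rewrite div1r lef_pV2 ?posrE ?ltr0n // [leLHS]pmulrn ler_int.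
  exact: m_eps.
- apply/seteqP; split=> [y [m <-]|y /xonto[m <-]] /=.
    by rewrite cE; case: (cx m).
  by exists m.
Qed.

End Existence.

Theorem theorem5 (R : realType) (F : R -> R -> R)
    (hF : strongly_symmetric_norm F) (alpha : R) (halpha : irrational alpha) :
  exists! c : cfrac,
    [/\ semi_regular c,
        expansion_of c alpha &
        [set x : rat | exists m : nat, convergent c m = x] =
        [set x : rat | best_approximation F alpha x]].
Proof.
have [c [hc ec cb]] := exists_best_expansion hF halpha.
exists c; split=> // c' [hc' ec' c'b].
apply: (expansion_unique halpha) => //.
have rE d : range (convergent d) = [set x | exists m, convergent d m = x].
  by apply/seteqP; split=> [y [m _ <-]|y [m <-]]; exists m.
by rewrite !rE cb c'b.
Qed.
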